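(* Let $(f,r)$, with $f\colon A\to B$ and $r\colon B\to A$, be a Schreier split epimorphism in the category $\mathcal{M}$ of cancellative conjugation monoids, with kernel $k\colon X\to A$ and Schreier retraction $q\colon A\to X$, and write $b\cdot x=q(r(b)+k(x))$. Then a morphism $h\colon X\to B$ in $\mathcal{M}$ induces a reflexive graph $$\tilde{h},f\colon A\rightrightarrows B,\qquad r\colon B\to A,$$ if and only if it satisfies the condition $$h(b\cdot x)+b=b+h(x)\quad\text{for all } b\in B \text{ and } x\in X.$$
   Context: A conjugation monoid $(M,+,0,\overline{(\;)})$ is a monoid (written additively but not assumed commutative) equipped with a unary operation $\overline{(\;)}\colon M\to M$ satisfying, for all $x,y$: $\overline{x}+x=x+\overline{x}$; $x+\overline{y}+y=y+\overline{y}+x$; $\overline{(x+y)}=\overline{y}+\overline{x}$. It is cancellative if its underlying monoid is (left and right) cancellative. The category $\mathcal{M}$ has cancellative conjugation monoids as objects and monoid homomorphisms preserving the conjugation as morphisms. A Schreier split epimorphism in $\mathcal{M}$ is a pair of morphisms $f\colon A\to B$, $r\colon B\to A$ in $\mathcal{M}$ with $fr=1_B$ such that, $k\colon X\to A$ being the kernel of $f$, there exists a unique set-theoretical map $q\colon A\to X$ (the Schreier retraction) with $a=kq(a)+rf(a)$ for every $a\in A$; equivalently, there is a map $q$ with $a=kq(a)+rf(a)$ and $x=q(k(x)+r(b))$ for all $a\in A$, $x\in X$, $b\in B$. A morphism $h\colon X\to B$ in $\mathcal{M}$ is said to induce a reflexive graph if there is a morphism $\tilde{h}\colon A\to B$ in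 $\mathcal{M}$ such that $\tilde{h}k=h$ and $\tilde{h}r=1_B$. *)

(* Defs.v *)
From HB Require Import structures.
From mathcomp Require Import all_boot all_algebra.

Set Implicit Arguments.
Unset Strict Implicit.
Unset Printing Implicit Defensive.

Import GRing.Theory.
Local Open Scope ring_scope.

(* MathComp's additive monoids ([nmodType]) are commutative and carry a choice
   structure; a conjugation monoid need have neither, so the hierarchy starts
   from [baseAddUMagmaType], which provides only [+] and [0], with no axioms. *)
HB.mixin Record BaseAddUMagma_isConjMonoid M of GRing.BaseAddUMagma M := {
  cmonoid_addA : forall x y z : M, x + (y + z) = (x + y) + z;
  cmonoid_add0l : forall x : M, 0 + x = x;
  cmonoid_add0r : forall x : M, x + 0 = x;
  mconj : M -> M;
  mconj_comm : forall x : M, mconj x + x = x + mconj x;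
  mconj_swap : forall x y : M, x + mconj y + y = y + mconj y + x;
  mconjD : forall x y : M, mconj (x + y) = mconj y + mconj x
}.

#[short(type="conjMonoidType")]
HB.structure Definition ConjMonoid :=
  {M of BaseAddUMagma_isConjMonoid M & GRing.BaseAddUMagma M}.

HB.mixin Record ConjMonoid_isCancellative M of ConjMonoid M := {
  cmonoid_addIl : forall x y z : M, x + y = x + z -> y = z;
  cmonoid_addIr : forall x y z : M, y + x = z + x -> y = z
}.

#[short(type="cancConjMonoidType")]
HB.structure Definition CancConjMonoid :=
  {M of ConjMonoid_isCancellative M & ConjMonoid M}.

HB.mixin Record isConjMorphism (A B : conjMonoidType) (f : A -> B) := {
  mconj_morph : forall x : A, f (mconj x) = mconj (f x)
}.

(* [Additive] on [baseAddUMagmaType] is preservation of [0] and [+]. *)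
HB.structure Definition ConjMonoidMorphism (A B : conjMonoidType) :=
  {f of isConjMorphism A B f & @GRing.Additive A B f}.

Notation "{ 'conjmorph' A -> B }" := (ConjMonoidMorphism.type A B)
  (at level 0, A at level 98, B at level 99,
   format "{ 'conjmorph'  A  ->  B }") : type_scope.

(* Kernel in the categorical sense, in the category of cancellative
   conjugation monoids. *)
Definition is_kernel (X A B : cancConjMonoidType)
    (k : {conjmorph X -> A}) (f : {conjmorph A -> B}) : Prop :=
  (forall x : X, f (k x) = 0) /\
  (forall (Z : cancConjMonoidType) (g : {conjmorph Z -> A}),
     (forall z : Z, f (g z) = 0) ->
     exists u : {conjmorph Z -> X},
       (forall z : Z, k (u z) = g z) /\
       (forall v : {conjmorph Z -> X},
          (forall z : Z, k (v z) = g z) -> v =1 u)).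

Definition schreier_retraction (X A B : cancConjMonoidType)
    (f : {conjmorph A -> B}) (r : {conjmorph B -> A})
    (k : {conjmorph X -> A}) (q : A -> X) : Prop :=
  forall a : A, a = k (q a) + r (f a).

Definition schreier_split_epi (X A B : cancConjMonoidType)
    (f : {conjmorph A -> B}) (r : {conjmorph B -> A})
    (k : {conjmorph X -> A}) : Prop :=
  [/\ (forall b : B, f (r b) = b),
      is_kernel k f
    & exists q : A -> X,
        schreier_retraction f r k q /\
        (forall q' : A -> X, schreier_retraction f r k q' -> q' =1 q)].

Definition schreier_act (X A B : cancConjMonoidType)
    (r : {conjmorph B -> A}) (k : {conjmorph X -> A}) (q : A -> X)
    (b : B) (x : X) : X :=
  q (r b + k x).

Definition induces_reflexive_graph (X A B : cancConjMonoidType)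
    (r : {conjmorph B -> A}) (k : {conjmorph X -> A})
    (h : {conjmorph X -> B}) : Prop :=
  exists ht : {conjmorph A -> B},
    (forall x : X, ht (k x) = h x) /\ (forall b : B, ht (r b) = b).

(* Main.v *)
Require Import Defs.
From HB Require Import structures.
From mathcomp Require Import all_boot all_algebra.
From Stdlib Require Import ClassicalEpsilon.
Import GRing.Theory.
Local Open Scope ring_scope.

(** Write [b.x] for [schreier_act r k q b x]. Decomposing [r b + k x] by the
    Schreier retraction gives [r b + k x = k (b.x) + r b]
    ([schreier_actE]), so any [ht] extending [h] along [k] and the identity
    along [r] sends the two sides of this identity to [b + h x] and
    [h (b.x) + b]: the condition is necessary.

    Conversely, [a = k (q a) + r (f a)] leaves only one candidate,
    [ht a = h (q a) + f a]. Every element of [A] is written uniquely as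
    [k x + r b] ([schreier_retractionK]), which makes [ht] restrict to [h] and
    to the identity. Moving [r (f a)] past [k (q a')] in [a + a'] yields
    [q (a + a') = q a + (f a).(q a')] ([schreier_retractionD]), and the
    condition is what turns this cocycle rule into additivity of [ht].
    Preservation of conjugation then costs nothing more: the conjugate of
    [k x + r b] is [r (mconj b) + k (mconj x)], on which [ht] is known by
    additivity. *)

(** Packs the axioms of a morphism, so that they can be proved for a function
    built in the course of a proof. *)
Lemma conjmorph_intro {A B : conjMonoidType} {g : A -> B} :
    g 0 = 0 -> (forall x y, g (x + y) = g x + g y) ->
    (forall x, g (mconj x) = mconj (g x)) ->
  exists g' : {conjmorph A -> B}, g' =1 g.
Proof.
move=> g0 gD gC.
pose gadd := GRing.isNmodMorphism.Build A B g (conj g0 gD).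
pose gconj := isConjMorphism.Build A B g gC.
pose g' : {conjmorph A -> B} := HB.pack g gadd gconj.
by exists g'.
Qed.

Section SchreierRetraction.

Context {X A B : cancConjMonoidType}.
Context {f : {conjmorph A -> B}} {r : {conjmorph B -> A}}.
Context {k : {conjmorph X -> A}} {q : A -> X}.
Context (fr_schreier : schreier_split_epi f r k).
Context (q_retr : schreier_retraction f r k q).

Lemma schreier_sectionK b : f (r b) = b.
Proof. by case: fr_schreier. Qed.

Lemma schreier_kernel0 x : f (k x) = 0.
Proof. by case: fr_schreier => _ []. Qed.

Lemma schreier_projE x b : f (k x + r b) = b.
Proof.
by rewrite raddfD /= schreier_kernel0 schreier_sectionK cmonoid_add0l.
Qed.

(** Uniqueness of the retraction as a function is uniqueness of each of its
    values: overriding [q] at the single element [k x + r b] by [x] gives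
    another retraction, which must agree with [q] there. *)
Lemma schreier_retractionK x b : q (k x + r b) = x.
Proof.
have [_ _ [p [_ p_uniq]]] := fr_schreier.
pose q' a :=
  if excluded_middle_informative (a = k x + r b) then x else q a.
have q'_retr : schreier_retraction f r k q'.
  move=> a; rewrite /q'; case: excluded_middle_informative => [a_val | _] /=.
    by rewrite [in RHS]a_val schreier_projE.
  exact: q_retr.
have <- : q' (k x + r b) = q (k x + r b).
  by rewrite (p_uniq _ q'_retr) (p_uniq _ q_retr).
by rewrite /q'; case: excluded_middle_informative.
Qed.

Lemma schreier_retraction_kernel x : q (k x) = x.
Proof.
by rewrite -[RHS](schreier_retractionK x 0) raddf0 /= cmonoid_add0r.
Qed.

Lemma schreier_retraction_section b : q (r b) = 0.
Proof.
by rewrite -[RHS](schreier_retractionK 0 b) raddf0 /= cmonoid_add0l.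
Qed.

Lemma schreier_actE b x : r b + k x = k (schreier_act r k q b x) + r b.
Proof.
rewrite [LHS]q_retr raddfD /= schreier_sectionK schreier_kernel0.
by rewrite cmonoid_add0r.
Qed.

Lemma schreier_retractionD a a' :
  q (a + a') = q a + schreier_act r k q (f a) (q a').
Proof.
rewrite -[RHS](schreier_retractionK _ (f a + f a')); congr q.
rewrite {1}[a]q_retr {1}[a']q_retr !raddfD /= -!cmonoid_addA; congr (_ + _).
by rewrite !cmonoid_addA schreier_actE.
Qed.

End SchreierRetraction.

Theorem proposition6p2 (X A B : cancConjMonoidType)
    (f : {conjmorph A -> B}) (r : {conjmorph B -> A})
    (k : {conjmorph X -> A}) (q : A -> X)
    (fr_schreier : schreier_split_epi f r k)
    (q_retr : schreier_retraction f r k q)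
    (h : {conjmorph X -> B}) :
  induces_reflexive_graph r k h <->
  (forall (b : B) (x : X), h (schreier_act r k q b x) + b = b + h x).
Proof.
split=> [[ht [htk htr]] b x | h_act].
  rewrite -htk -[in RHS]htk -{2 3}[b]htr -!raddfD /=.
  by rewrite (schreier_actE fr_schreier q_retr).
pose g a := h (q a) + f a.
have gk x : g (k x) = h x.
  rewrite /g (schreier_retraction_kernel fr_schreier q_retr).
  by rewrite (schreier_kernel0 fr_schreier) cmonoid_add0r.
have gr b : g (r b) = b.
  rewrite /g (schreier_retraction_section fr_schreier q_retr).
  by rewrite (schreier_sectionK fr_schreier) raddf0 /= cmonoid_add0l.
have gD a a' : g (a + a') = g a + g a'.
  rewrite /g (schreier_retractionD fr_schreier q_retr) !raddfD /=.
  rewrite -!cmonoid_addA; congr (_ + _).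
  by rewrite !cmonoid_addA h_act.
have g0 : g 0 = 0 by rewrite -(raddf0 k) gk raddf0.
have gC a : g (mconj a) = mconj (g a).
  rewrite {1}[a]q_retr mconjD -!mconj_morph gD gr gk.
  by rewrite /g mconjD !mconj_morph.
have [ht htE] := conjmorph_intro g0 gD gC.
by exists ht; split=> [x | b]; rewrite htE.
Qed.
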